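(* Let $p$ be an odd prime, $m$ a positive integer, $q=p^m$, $u$ a positive integer and $v=\gcd(m,u)$. Let $\mathrm{Tr}$ denote the trace map from $\mathbb{F}_q$ to $\mathbb{F}_p$, $\zeta_p=e^{2\pi\sqrt{-1}/p}$, $\eta$ the quadratic multiplicative character of $\mathbb{F}_q$, and $G(\eta)=\sum_{x\in\mathbb{F}_q^*}\eta(x)\zeta_p^{\mathrm{Tr}(x)}$. Let \[ D_1=\{(x,y)\in\mathbb{F}_q^2\setminus\{(0,0)\} : \mathrm{Tr}(x+y^{p^u+1})=0\}, \] and $C_{D_1}=\{c(a,b)=(\mathrm{Tr}(ax+by))_{(x,y)\in D_1} : a,b\in\mathbb{F}_q\}$. If $\frac{m}{v}$ is odd and $v$ is even, then $C_{D_1}$ is a $[p^{2m-1}-1,2m]$ three-weight linear code over $\mathbb{F}_p$ whose weight distribution is: weight $0$ with multiplicity $1$; weight $(p-1)p^{2m-2}$ with multiplicity $p^{2m}-1-(p-1)p^m$; weight $(p-1)p^{2m-2}\left(1-\frac{G(\eta)}{q}\right)$ with multiplicity $(p-1)p^{m-1}\left(1+\frac{(p-1)G(\eta)}{q}\right)$; and weight $(p-1)p^{2m-2}\left(1+\frac{G(\eta)}{(p-1)q}\right)$ with multiplicity $(p-1)p^{m-1}\left(p-1-\frac{(p-1)G(\eta)}{q}\right)$.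
   Context: An $[n,k]$ linear code over $\mathbb{F}_p$ is a $k$-dimensional subspace of $\mathbb{F}_p^n$. The multiplicity of a weight $w$ is the number of codewords of Hamming weight $w$; a code is $t$-weight if exactly $t$ nonzero weights occur. *)

(* Defs.v *)
From HB Require Import structures.
From mathcomp Require Import all_boot all_order all_algebra all_field.
Unset Printing Implicit Defensive.
Import Order.TTheory GRing.Theory Num.Theory.
Local Open Scope ring_scope.

Section Defs.
Variables (p m : nat) (F : finFieldType).

Definition trF (x : F) : F := \sum_(i < m) x ^+ (p ^ i).

Definition Tr (x : F) : 'F_p :=
  odflt 0 [pick k : 'F_p | ((k : nat)%:R : F) == trF x].

(* quadratic multiplicative character of F_q (on nonzero elements) *)
Definition eta (x : F) : algC :=
  if [exists y : F, y ^+ 2 == x] then 1 else -1.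

(* zeta_p = exp(2 pi i / p) = (exp(i pi / p))^2; p.-root (-1) is exp(i pi/p) *)
Definition zetap : algC := (p.-root (-1)) ^+ 2.

Definition gauss_eta : algC :=
  \sum_(x : F | x != 0) eta x * zetap ^+ (Tr x : nat).

Definition D1 (u : nat) : {set F * F} :=
  [set z : F * F | (z != (0, 0)) && (Tr (z.1 + z.2 ^+ (p ^ u).+1) == 0)].

(* codeword c(a,b) indexed by (x,y) in D_1 (zero outside D_1, irrelevant) *)
Definition cw (u : nat) (a b : F) : {ffun F * F -> 'F_p} :=
  [ffun z : F * F => if z \in D1 u then Tr (a * z.1 + b * z.2) else 0].

Definition code (u : nat) : {set {ffun F * F -> 'F_p}} :=
  [set cw u ab.1 ab.2 | ab : F * F].

Definition wt (u : nat) (c : {ffun F * F -> 'F_p}) : nat :=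
  #|[set z in D1 u | c z != 0]|.

Definition mult (u : nat) (w : algC) : nat :=
  #|[set c in code u | (wt u c)%:R == w]|.

End Defs.

(* Main.v *)
(** With d = p^u + 1 = 2e, the exponent e is odd and y |-> y^e permutes F_q, so
    y^d has the same distribution as y^2.  Let N(s) be the number of y with
    Tr(y^2) = s.  As m is even, every element of F_p^* is a square in F_q, so
    N(s) = N(1) for s <> 0; hence N(0) + (p-1) N(1) = q and G(eta) = N(0) - N(1).
    Parity (y |-> -y) gives N(0) <> N(1).

    The codeword c(a,b) vanishes at q^2/p^2 points of {Tr(x + y^d) = 0} if a is
    not in F_p^* and (a,b) <> 0.  If a is in F_p^*, eliminating x leaves
    p^(m-1) times the number of y with Tr(y^d + By) = 0, where B = -b/a.
    Completing the "square", y^d + By has the trace of (y+c)^d - c^d where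
    c + c^(p^(2u)) = B^(p^u), so this number is N(Tr(c^d)); and B |-> c is a
    bijection, because m/gcd(m,u) is odd. *)

Require Import Defs.
From HB Require Import structures.
From mathcomp Require Import all_boot all_order all_algebra all_field.
From mathcomp Require Import cyclic ring zify.
Import Order.TTheory GRing.Theory Num.Theory.
Local Open Scope ring_scope.
Set Implicit Arguments.
Unset Strict Implicit.

Arguments Tr p m F x%_ring_scope.

(** * Counting by reindexing and by fibres *)

Lemma card_eq_reindex (T : finType) (h : T -> T) (P Q : pred T) :
  injective h -> (forall x, P (h x) = Q x) -> #|[set x | P x]| = #|[set x | Q x]|.
Proof.
move=> hi PQ; rewrite -(card_imset [set x | Q x] hi); congr #|pred_of_set _|.
have [g gK Kg] := injF_bij hi; apply/setP => x; rewrite !inE.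
apply/idP/imsetP => [Px|[y]]; last by rewrite inE -PQ => Py ->.
by exists (g x); rewrite ?inE -?PQ Kg.
Qed.

Lemma card_fiber_sum (T S : finType) (A : {set T}) (f : T -> S) :
  #|A| = (\sum_s #|[set x in A | f x == s]|)%N.
Proof.
rewrite -sum1_card (partition_big f predT) //=; apply: eq_bigr => s _.
by rewrite -sum1dep_card.
Qed.

(** With s = 2r+1, s^2 + 1 = 2(2r(r+1) + 1). It is applied to s = p^(u/2). *)
Lemma half_odd_sqrS s : odd s -> exists2 e, (s ^ 2).+1 = e.*2 & odd e.
Proof.
move=> os; have sE := odd_double_half s; rewrite os in sE.
exists (s./2 * s./2.+1).*2.+1; last by rewrite /= odd_double.
by rewrite -{1}sE; move: (s./2) => r; nia.
Qed.

(** A translation carries any fibre onto any other, so all have equal size. This replaces a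
    dimension count for kernels of trace forms. *)
Lemma card_fiber_translation (U : finZmodType) (V : finType) (f : U -> V) :
  (forall v w, exists t, forall x, (f (x + t) == w) = (f x == v)) ->
  forall v, (#|V| * #|[set u | f u == v]| = #|U|)%N.
Proof.
move=> tf v.
rewrite -sum_nat_const -[RHS]cardsT [RHS](card_fiber_sum _ f).
apply: eq_bigr => w _; have [t tE] := tf v w.
have /= <- := card_eq_reindex (P := fun x => f x == w) (@addIr _ t) tE.
by apply: eq_card => x; rewrite !inE.
Qed.

(** * The root of unity *)

Lemma zetap_exp p : (0 < p)%N -> zetap p ^+ p = 1.
Proof. by move=> p0; rewrite /zetap -exprM mulnC exprM rootCK // sqrrN expr1n. Qed.

Lemma zetap_neq1 p : odd p -> (1 < p)%N -> zetap p != 1.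
Proof.
move=> po p1; have rK := rootCK (ltnW p1) (-1 : algC).
rewrite /zetap sqrf_eq1 negb_or; apply/andP; split; apply/eqP => r1.
  move: rK; rewrite r1 expr1n => /eqP; rewrite -subr_eq0 opprK.
  by rewrite -[1 + 1](natrD _ 1 1) pnatr_eq0.
(* As p is odd, -1 is itself a p-th root of -1; only the choice made by [p.-root], which is never
   negative, excludes it. *)
by have := rootC_lt0 (-1 : algC) p1; rewrite r1 oppr_lt0 ltr01.
Qed.

Lemma sum_zetap p : prime p -> odd p -> \sum_(s : 'F_p) zetap p ^+ s = 0.
Proof.
move=> hp po; have z1 := zetap_neq1 po (prime_gt1 hp).
have := subrX1 (zetap p) p; rewrite zetap_exp ?prime_gt0 // subrr => /esym/eqP.
rewrite mulf_eq0 subr_eq0 (negPf z1) /= => /eqP E; rewrite -[RHS]E.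
(* The ordinal bound hidden in ['F_p] equals p only propositionally. *)
have cast n : n = p -> \sum_(s < n) zetap p ^+ s = \sum_(s < p) zetap p ^+ s by move->.
exact: cast (Fp_cast hp).
Qed.

Lemma card_set_pair (T S : finType) (P : T -> S -> bool) :
  #|[set z : T * S | P z.1 z.2]| = (\sum_x #|[set y | P x y]|)%N.
Proof.
rewrite -sum1dep_card (eq_bigr (fun x => \sum_(y | P x y) 1)%N) => [|x _].
  by rewrite pair_big_dep.
by rewrite sum1dep_card.
Qed.

Lemma card_set_pair_swap (T S : finType) (P : T -> S -> bool) :
  #|[set z : T * S | P z.1 z.2]| = (\sum_y #|[set x | P x y]|)%N.
Proof.
rewrite card_set_pair (eq_bigr (fun x => \sum_(y | P x y) 1)%N) => [|x _].
  rewrite (exchange_big_dep predT) //=; apply: eq_bigr => y _.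
  by rewrite sum1dep_card.
by rewrite sum1dep_card.
Qed.

(** * Arithmetic of the three weights *)

Lemma expn_split p m : (0 < m)%N ->
  [/\ p ^ m = p * p ^ (m - 1),
      p ^ (2 * m - 1) = p * (p ^ (m - 1) * p ^ (m - 1)) &
      p ^ (2 * m - 2) = p ^ (m - 1) * p ^ (m - 1)]%N.
Proof. by move=> m0; rewrite -!expnD -!expnS; split; congr expn; lia. Qed.

(** To be read with r = p-1, P = p^(m-1), a = N(0), b = N(1). The weight r P^2 is w(P), and P is a
    weighted mean of a and b; so a <> b makes a, b, P distinct, and all three stay below (r+1)P. *)
Lemma weights_distinct r P a b : (1 < r)%N -> (0 < P)%N -> (0 < a)%N -> (0 < b)%N ->
  a != b -> (a + r * b = r.+1 * P)%N ->
  let w x := (r.+1 * (P * P) - P * x)%N in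
  [/\ 0 < r * (P * P), 0 < w a & 0 < w b]%N /\
  [/\ (r * (P * P))%N != w a, (r * (P * P))%N != w b & w a != w b].
Proof.
move=> r1 P0 a0 b0 ab E w.
have r0 : (0 < r)%N by apply: ltnW.
have wE x : w x = (P * (r.+1 * P - x))%N by rewrite /w mulnBr mulnCA.
have gE : (r * (P * P) = P * (r.+1 * P - P))%N.
  by rewrite mulSn addKn mulnCA.
have ble : (b <= r * b)%N by rewrite leq_pmull.
have aP : a != P.
  apply: contraNneq ab => aP; move: E; rewrite aP mulSn => /addnI/eqP.
  by rewrite eqn_pmul2l // eq_sym.
have bP : b != P.
  by apply: contraNneq aP => bP; move: E; rewrite bP mulSn => /addIn/eqP.
have Ple : (P < r.+1 * P)%N by rewrite mulSn -addn1 leq_add2l muln_gt0 r0.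
rewrite !gE !wE !muln_gt0 !eqn_pmul2l // P0.
move: (r.+1 * P)%N E Ple => X E Ple; move: (r * b)%N E ble => Y E ble.
by split; split; lia.
Qed.

(** * The prime field inside F, and Frobenius powers *)

Definition embFp p (F : finFieldType) (k : 'F_p) : F := (k : nat)%:R.
Arguments embFp : clear implicits.

Section Code.
Context (p m : nat) (F : finFieldType) (hp : prime p) (hm : (0 < m)%N)
  (hF : #|F| = (p ^ m)%N).

Let hc : p \in [pchar F] := card_finPcharP hF hp.
Local Notation emb := (embFp p F).

Lemma embFp_nat n : emb n%:R = n%:R.
Proof. by rewrite /embFp val_Fp_nat // (GRing.natr_mod_pchar hc). Qed.

Lemma embFpD k l : emb (k + l) = emb k + emb l.
Proof. by rewrite -{1}(natr_Zp k) -{1}(natr_Zp l) -natrD embFp_nat natrD. Qed.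

Lemma embFpM k l : emb (k * l) = emb k * emb l.
Proof. by rewrite -{1}(natr_Zp k) -{1}(natr_Zp l) -natrM embFp_nat natrM. Qed.

Lemma embFp0 : emb 0 = 0. Proof. exact: (embFp_nat 0). Qed.

Lemma embFpN k : emb (- k) = - emb k.
Proof. by apply/eqP; rewrite -addr_eq0 -embFpD addNr embFp0. Qed.

Lemma embFp_eq0 k : (emb k == 0) = (k == 0).
Proof.
rewrite /embFp -(dvdn_pcharf hc).
have ltkp : (k < p)%N by rewrite -[X in (_ < X)%N](Fp_cast hp).
apply/idP/eqP => [dv|->]; last exact: dvdn0.
apply: val_inj => /=; case: (posnP k) => // k0.
by move: (dvdn_leq k0 dv); rewrite leqNgt ltkp.
Qed.

Lemma embFp_inj : injective emb.
Proof.
move=> k l ekl; apply/eqP; rewrite -subr_eq0 -embFp_eq0 embFpD embFpN ekl.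
by rewrite subrr.
Qed.

Lemma embFpX k : emb k ^+ p = emb k.
Proof. exact: (pFrobenius_aut_nat hc). Qed.

(** The p elements of the prime field are already roots of X^p - X; any other fixed point would be
    one root too many. *)
Lemma embFp_fixed (x : F) : x ^+ p = x -> exists k, x = emb k.
Proof.
move=> xp; case: (boolP (x \in [seq emb k | k in 'F_p])) => [|xn].
  by case/imageP => k _ ->; exists k.
have sz : size ('X^p - 'X : {poly F}) = p.+1.
  by rewrite size_polyDl ?size_polyXn // size_polyN size_polyX ltnS prime_gt1.
have nz : 'X^p - 'X != 0 :> {poly F} by rewrite -size_poly_eq0 sz.
suff: (size (x :: [seq emb k | k in 'F_p]) < p.+1)%N.
  by rewrite /= size_map -cardE card_Fp // ltnn.
rewrite -sz; apply: max_poly_roots => //=.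
  rewrite {1}/root !hornerE xp subrr eqxx /=; apply/allP => _ /imageP[k _ ->].
  by rewrite /root !hornerE embFpX subrr.
by rewrite xn (map_inj_uniq embFp_inj) enum_uniq.
Qed.

Lemma pnat_pchar n : [pchar F].-nat (p ^ n)%N.
Proof.
by rewrite pnatX pnatE // hc.
Qed.

Lemma frobD n (x y : F) : (x + y) ^+ (p ^ n) = x ^+ (p ^ n) + y ^+ (p ^ n).
Proof. exact: exprDn_pchar (pnat_pchar n). Qed.

Lemma frobN n (x : F) : (- x) ^+ (p ^ n) = - x ^+ (p ^ n).
Proof. exact: exprNn_pchar (pnat_pchar n). Qed.

Lemma frob_inj n : injective (fun x : F => x ^+ (p ^ n)).
Proof.
move=> x y /eqP; rewrite /= -subr_eq0 -frobN -frobD expf_eq0 subr_eq0.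
by case/andP => _ /eqP.
Qed.

Lemma frob_embFp n k : emb k ^+ (p ^ n) = emb k.
Proof. by elim: n => [|n IH]; rewrite ?expn0 ?expr1 // expnSr exprM IH embFpX. Qed.

(** * The trace form *)

Local Notation tr := (Tr p m F).

(** The default value in [Tr] is never reached: since x^(p^m) = x, Frobenius permutes the summands
    of [trF] cyclically, so their sum lies in the prime field. *)
Lemma embFp_Tr x : emb (tr x) = trF p m F x.
Proof.
rewrite /Tr; case: pickP => [k /eqP //|none].
have fx : trF p m F x ^+ p = trF p m F x.
  rewrite /trF -(pFrobenius_autE hc) rmorph_sum /=.
  case: m hm hF none => // n _ hFn _.
  rewrite big_ord_recr [RHS]big_ord_recl /= expn0 expr1 addrC.
  congr (_ + _); first by rewrite pFrobenius_autE -exprM -expnSr -hFn expf_card.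
  by apply: eq_bigr => i _; rewrite pFrobenius_autE -exprM -expnSr.
have [k ek] := embFp_fixed fx.
by have := none k; rewrite ek eqxx.
Qed.

Lemma TrD x y : tr (x + y) = tr x + tr y.
Proof.
apply: embFp_inj; rewrite embFpD !embFp_Tr /trF -big_split /=.
by apply: eq_bigr => i _; rewrite frobD.
Qed.

Lemma TrN x : tr (- x) = - tr x.
Proof.
apply: embFp_inj; rewrite embFpN !embFp_Tr /trF -sumrN.
by apply: eq_bigr => i _; rewrite frobN.
Qed.

Lemma TrB x y : tr (x - y) = tr x - tr y. Proof. by rewrite TrD TrN. Qed.

Lemma Tr0 : tr 0 = 0. Proof. by rewrite -(subrr 0) TrB subrr. Qed.

Lemma TrZ k x : tr (emb k * x) = k * tr x.
Proof.
apply: embFp_inj; rewrite embFpM !embFp_Tr /trF big_distrr /=.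
by apply: eq_bigr => i _; rewrite exprMn frob_embFp.
Qed.

Lemma Tr_frob n x : tr (x ^+ (p ^ n)) = tr x.
Proof.
elim: n x => [|n IH] x; rewrite ?expn0 ?expr1 // expnSr exprM.
rewrite -[RHS](IH x); move: (x ^+ _) => {IH n}x.
apply: embFp_inj; rewrite !embFp_Tr /trF.
case: m hm hF => // n _ hFn.
rewrite big_ord_recr [RHS]big_ord_recl /= expn0 expr1 addrC.
congr (_ + _); first by rewrite -exprM -expnS -hFn expf_card.
by apply: eq_bigr => i _; rewrite -exprM -expnS.
Qed.

(** An identically zero trace would give a polynomial of degree p^(m-1) with p^m roots; a nonzero
    trace value is then scaled to 1. *)
Lemma Tr_onto : exists x, tr x = 1.
Proof.
suff [x xn] : exists x, tr x != 0.
  by exists (emb (tr x)^-1 * x); rewrite TrZ mulVf.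
apply/existsP; rewrite -[[exists _, _]]negbK negb_exists; apply/negP => /forallP tr0.
pose P : {poly F} := \sum_(i < m) 'X^(p ^ i).
have szP : size P = (p ^ m.-1).+1.
  rewrite /P; case: m hm => // n _; rewrite big_ord_recr /= addrC size_polyDl size_polyXn //.
  apply: leq_ltn_trans (size_sum _ _ _) _; rewrite ltnS.
  by apply/bigmax_leqP => i _; rewrite size_polyXn ltn_exp2l ?prime_gt1.
have nz : P != 0 by rewrite -size_poly_eq0 szP.
have := max_poly_roots nz (rs := enum F).
rewrite enum_uniq szP -cardE hF ltnS leqNgt ltn_exp2l ?prime_gt1 // prednK // leqnn.
have -> : all (root P) (enum F).
  apply/allP => x _; rewrite /root horner_sum.
  have /eqP := negbNE (tr0 x); move/(congr1 emb).
  rewrite embFp_Tr embFp0 /trF => E; apply/eqP; rewrite -[RHS]E.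
  by apply: eq_bigr => i _; rewrite hornerXn.
by move=> /(_ isT isT).
Qed.

Lemma Tr_nondeg a : (forall x, tr (a * x) = 0) -> a = 0.
Proof.
move=> tr0; apply/eqP; apply: contraT => an0; have [x x1] := Tr_onto.
by move: (tr0 (a^-1 * x)); rewrite mulVKf // x1 => /eqP; rewrite oner_eq0.
Qed.

(* Otherwise Tr (a x) would be a multiple of Tr x on all of F, putting a in F_p. *)
Lemma Tr_indep a : (forall k, a != emb k) ->
  exists2 h, tr h = 0 & tr (a * h) = 1.
Proof.
move=> an; have [x1 tx1] := Tr_onto.
case: (pickP [pred h | (tr h == 0) && (tr (a * h) != 0)]) => [h|none].
  case/andP => /eqP h0 hn; exists (emb (tr (a * h))^-1 * h).
    by rewrite TrZ h0 mulr0.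
  by rewrite mulrCA TrZ mulVf.
case/negP: (an (tr (a * x1))); rewrite -subr_eq0; apply/eqP; apply: Tr_nondeg => x.
have := none (x - emb (tr x) * x1).
rewrite inE /= TrB TrZ tx1 mulr1 subrr eqxx /= => /negbFE/eqP.
by rewrite mulrBr mulrCA mulrBl !TrB !TrZ (mulrC (tr x)).
Qed.

(** * Consequences of the parity of m/v and v *)

Context (u : nat) (hodd : odd p)
  (hmv : odd (m %/ gcdn m u)) (hv : ~~ odd (gcdn m u)).

Lemma even_of_gcdn : ~~ odd m /\ ~~ odd u.
Proof.
by split; apply: contra hv => ho; [apply: dvdn_odd (dvdn_gcdl _ _) ho
  | apply: dvdn_odd (dvdn_gcdr _ _) ho].
Qed.

Lemma frob_multiple j (x : F) : x ^+ (p ^ (m * j)) = x.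
Proof.
elim: j => [|j IH]; first by rewrite muln0 expn0 expr1.
by rewrite mulnS expnD exprM -hF expf_card.
Qed.

(* As m / gcd m u is odd, some odd iterate of y |-> y^(p^u) is the identity, so
   y |-> y^(p^u) cannot act on a point as a nontrivial involution (y^-1 or -y). *)
Lemma frob_odd_multiple (x : F) : x ^+ (p ^ (u * (m %/ gcdn m u))) = x.
Proof.
have /dvdnP[k uE] := dvdn_gcdr m u; have g0 : (0 < gcdn m u)%N by rewrite gcdn_gt0 hm.
by rewrite {1}uE -mulnA [(gcdn m u * _)%N]mulnC divnK ?dvdn_gcdl // mulnC frob_multiple.
Qed.

Lemma two_neq0 : 2%:R != 0 :> F.
Proof.
rewrite -(dvdn_pcharf hc); apply/negP => /dvdn_leq -/(_ isT).
by case: p hp hodd => [|[|[|]]].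
Qed.

Lemma oppr_fixed (x : F) : - x = x -> x = 0.
Proof.
move/eqP; rewrite eq_sym -subr_eq0 opprK -mulr2n -mulr_natl mulf_eq0.
by rewrite (negPf two_neq0) => /eqP.
Qed.

(** The iterates alternate between w^-1 and w, and an odd one is the identity. *)
Lemma frob_invr_fixed (w : F) : w ^+ (p ^ u) = w^-1 -> w^-1 = w.
Proof.
move=> wu; suff it j : w ^+ (p ^ (u * j)) = if odd j then w^-1 else w.
  by have := frob_odd_multiple w; rewrite it hmv.
elim: j => [|j IH]; first by rewrite muln0 expn0 expr1.
by rewrite mulnS expnD exprM wu exprVn IH /=; case: (odd j); rewrite ?invrK.
Qed.

(** After m/gcd(m,u) iterations, an odd number, c has become -c; yet that composite is the identity,
    and the characteristic is odd. *)
Lemma frob_oppr_eq0 (c : F) : c ^+ (p ^ (2 * u)) = - c -> c = 0.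
Proof.
move=> cu; suff it j : c ^+ (p ^ (2 * u * j)) = if odd j then - c else c.
  apply: oppr_fixed; have := it (m %/ gcdn m u)%N.
  rewrite hmv => <-; rewrite -mulnA mulnC muln2 -addnn expnD exprM.
  by rewrite !frob_odd_multiple.
elim: j => [|j IH]; first by rewrite muln0 expn0 expr1.
rewrite mulnS expnD exprM cu frobN IH /=.
by case: (odd j); rewrite ?opprK.
Qed.

Lemma half_exponent : exists2 e, (p ^ u).+1 = e.*2 & odd e.
Proof.
(* As u is even, p^u is the square of the odd number p^(u/2). *)
have [_ u_even] := even_of_gcdn; rewrite -(even_halfK u_even) -muln2 expnM.
by apply: half_odd_sqrS; rewrite oddX hodd orbT.
Qed.

(** If y^e = z^e with z nonzero, w = y/z has w^(p^u+1) = w^(2e) = 1, so w^(p^u) = w^-1. Hence w^2 =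
    1, and w = w^e = 1 because e is odd. *)
Lemma half_exponent_inj e : (p ^ u).+1 = e.*2 -> odd e ->
  injective (fun y : F => y ^+ e).
Proof.
move=> eE oe y z /= yz; have e0 : (0 < e)%N by case: e oe {eE yz}.
case: (eqVneq z 0) => [z0|z0].
  move: yz; rewrite z0 expr0n eqn0Ngt e0 /= => /eqP.
  by rewrite expf_eq0 e0 => /eqP.
suff w1 : y / z = 1 by rewrite -[y](divfK z0) w1 mul1r.
have we : (y / z) ^+ e = 1 by rewrite expr_div_n yz divff // expf_neq0.
move: (y / z) we => w we {y z yz z0}.
have w0 : w != 0 by apply: contra_eq_neq we => ->; rewrite expr0n eqn0Ngt e0 eq_sym oner_neq0.
have wV : w^-1 = w.
  apply: frob_invr_fixed; apply: (mulfI w0).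
  by rewrite -exprS eE -muln2 exprM we expr1n divff.
have w2 : w ^+ 2 = 1 by rewrite expr2 -{1}wV mulVf.
by rewrite -we -[in RHS](odd_double_half e) oe -muln2 mulnC exprD exprM w2 expr1n mulr1 expr1.
Qed.

(** The map is additive with trivial kernel by [frob_oppr_eq0]. *)
Lemma linearized_inj : injective (fun c : F => c + c ^+ (p ^ (2 * u))).
Proof.
move=> x y /= xy; apply/eqP; rewrite -subr_eq0; apply/eqP; apply: frob_oppr_eq0.
rewrite frobD frobN; apply/eqP; rewrite -subr_eq0; apply/eqP.
apply: (addrI (y + y ^+ (p ^ (2 * u)))); rewrite addr0 -{2}xy; ring.
Qed.

(** For nonzero k, write its image as g^j with g a generator of F^*. Its (p-1)-th power is 1, so
    (p^m - 1)/(p - 1), an even number, divides j. *)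
Lemma embFp_square (k : 'F_p) : exists r : F, r ^+ 2 = embFp p F k.
Proof.
case: (eqVneq k 0) => [->|k0]; first by exists 0; rewrite expr0n embFp0.
have [m_even _] := even_of_gcdn.
pose x : F := embFp p F k; have x0 : x != 0 by rewrite embFp_eq0.
have q0 : (0 < p ^ m - 1)%N by rewrite subn_gt0 -{1}(expn0 p) ltn_exp2l ?prime_gt1.
have unity y : y != 0 -> y ^+ (p ^ m - 1) = 1 :> F.
  move=> y0; apply: (mulfI y0); rewrite -exprS -addn1 subnK ?expn_gt0 ?prime_gt0 //.
  by rewrite -hF expf_card mulr1.
have := @has_prim_root F (p ^ m - 1) (enum [pred y : F | y != 0]) q0.
rewrite enum_uniq -cardE.
have -> : #|[pred y : F | y != 0]| = (p ^ m - 1)%N.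
  by rewrite -hF (cardC1 0) subn1.
rewrite leqnn => /(_ _ isT isT)/hasP[|g _ prim_g].
  by apply/allP => y; rewrite mem_enum inE unity_rootE => /unity ->.
have [[j /= _] xE] := prim_rootP prim_g (unity x x0).
suff j_even : ~~ odd j.
  by exists (g ^+ j./2); rewrite -exprM muln2 even_halfK // -xE.
have xp1 : x ^+ (p - 1) = 1.
  apply: (mulfI x0); rewrite -exprS -addn1 subnK ?prime_gt0 // mulr1.
  exact: embFpX.
have : (p ^ m - 1 %| j * (p - 1))%N.
  by rewrite (prim_order_dvd prim_g) exprM -xE xp1.
(* (p^m - 1) / (p - 1) is even because m is. *)
have -> : (p ^ m - 1 = (p ^ 2 - 1) * (\sum_(i < m./2) p ^ (2 * i)))%N.
  rewrite -{1}(even_halfK m_even) -muln2 mulnC expnM !subn1 predn_exp.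
  by congr (_ * _)%N; apply: eq_bigr => i _; rewrite expnM.
have -> : (p ^ 2 - 1 = (p + 1) * (p - 1))%N by rewrite -[1%N in LHS](exp1n 2) subn_sqr mulnC.
rewrite mulnAC dvdn_pmul2r ?subn_gt0 ?prime_gt1 // => dj.
suff : (2 %| j)%N by rewrite dvdn2.
by apply: dvdn_trans dj; apply: dvdn_mulr; rewrite dvdn2 addn1 /= hodd.
Qed.

(** * Fibres of the trace and the distribution of Tr(y^2) *)

Definition trsq_count (s : 'F_p) := #|[set y : F | tr (y ^+ 2) == s]|.
Arguments trsq_count s%_ring_scope.
Local Notation N := trsq_count.

Lemma Tr_surj s : exists x, tr x = s.
Proof.
by have [x x1] := Tr_onto; exists (emb s * x); rewrite TrZ x1 mulr1.
Qed.

Lemma card_Tr_fiber s : #|[set x | tr x == s]| = (p ^ (m - 1))%N.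
Proof.
apply/eqP; rewrite -(eqn_pmul2l (prime_gt0 hp)) -expnS subn1 prednK // -hF.
rewrite -{1}(card_Fp hp) card_fiber_translation // => v w.
have [t tE] := Tr_surj (w - v); exists t => x.
by rewrite TrD tE addrCA -subr_eq0 addrAC subrr add0r subr_eq0.
Qed.

Lemma gt1_m : (1 < m)%N.
Proof. by have [+ _] := even_of_gcdn; case: m hm => [|[]]. Qed.

(** The forms Tr(x) and Tr(ax) are independent by [Tr_indep], so the pair takes all p^2 values
    equally often. *)
Lemma card_Tr_fiber2 a s t : (forall k, a != emb k) ->
  #|[set x | (tr x == s) && (tr (a * x) == t)]| = (p ^ (m - 2))%N.
Proof.
move=> an; apply/eqP; have p2 : (0 < p ^ 2)%N by rewrite expn_gt0 prime_gt0.
rewrite -(eqn_pmul2l p2) -expnD subnKC ?gt1_m // -hF.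
pose f x := (tr x, tr (a * x)).
have f_trans v w : exists t, forall x, (f (x + t) == w) = (f x == v).
  case: v w => v1 v2 [w1 w2]; have [h h0 h1] := Tr_indep an.
  have [y yE] := Tr_surj (w1 - v1).
  (* Adding y corrects the first coordinate; the multiple of h then corrects the second without
     disturbing the first, as Tr(h) = 0 and Tr(ah) = 1. *)
  exists (y + emb (w2 - v2 - tr (a * y)) * h) => x.
  rewrite /f !xpair_eqE !mulrDr (mulrCA a) !TrD !TrZ h0 h1 mulr0 mulr1 addr0 yE.
  rewrite [tr (a * y) + _]addrC subrK.
  by congr (_ && _); rewrite addrCA -subr_eq0 addrAC subrr add0r subr_eq0.
by rewrite -(card_fiber_translation f_trans (s, t)) card_prod card_Fp //.
Qed.

Lemma card_sqrt (x : F) : #|[set y : F | y ^+ 2 == x]| =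
  if x == 0 then 1%N else if [exists y : F, y ^+ 2 == x] then 2%N else 0%N.
Proof.
case: eqP => [->|/eqP x0].
  rewrite -[RHS](cards1 (0 : F)); apply: eq_card => y.
  by rewrite !inE sqrf_eq0.
case: (boolP [exists y, _]) => [/existsP[y /eqP yx]|/existsPn none].
  rewrite -yx; have yN : y != - y.
    apply: contraNneq x0 => yy; have /eqP := oppr_fixed (esym yy).
    by rewrite -yx sqrf_eq0.
  transitivity #|[set y; - y]|; last by rewrite cards2 yN.
  by apply: eq_card => w; rewrite !inE eqf_sqr.
by apply: eq_card0 => y; rewrite !inE; apply/negbTE/none.
Qed.

Lemma trsq_count_scale s : s != 0 -> N s = N 1.
Proof.
move=> s0; have [r rs] := embFp_square s.
have r0 : r != 0.
  by rewrite -sqrf_eq0 rs embFp_eq0.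
apply: (card_eq_reindex (h := fun y => r * y)); first exact: mulfI.
move=> y /=; rewrite exprMn rs TrZ -{2}(mulr1 s).
by rewrite (inj_eq (mulfI s0)).
Qed.

Lemma trsq_count_total : (N 0 + (p - 1) * N 1 = p ^ m)%N.
Proof.
rewrite -hF -cardsT (card_fiber_sum _ (fun y => tr (y ^+ 2))).
rewrite (bigD1 0) //=; congr (_ + _)%N.
  by apply: eq_card => y; rewrite !inE.
rewrite (eq_bigr (fun _ => N 1)).
  by rewrite sum_nat_const (cardC1 (0 : 'F_p)) card_Fp // subn1.
by move=> s s0; rewrite -(trsq_count_scale s0); apply: eq_card => y; rewrite !inE.
Qed.

(** A nonzero x has no or two square roots, so modulo 2 only y = 0 counts, and its trace is 0. *)
Lemma trsq_count_odd s : odd (N s) = (s == 0).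
Proof.
rewrite /N (card_fiber_sum _ (fun y : F => y ^+ 2)).
have E x : #|[set y in [set y : F | tr (y ^+ 2) == s] | y ^+ 2 == x]|
   = (if tr x == s then #|[set y : F | y ^+ 2 == x]| else 0)%N.
  case: ifP => trx; [apply: eq_card|apply: eq_card0] => y; rewrite !inE;
    by case: (eqVneq (y ^+ 2) x) => [->|_]; rewrite ?trx ?andbF.
rewrite (bigD1 0) //= E Tr0 card_sqrt eqxx oddD eq_sym.
have -> : odd (\sum_(x : F | x != 0%R)
    #|[set y in [set y : F | tr (y ^+ 2) == s] | y ^+ 2 == x]|)%N = false.
  apply: (big_rec (fun k => odd k = false)) => // x k x0 ok.
  by rewrite oddD ok E card_sqrt (negPf x0); do 2?case: ifP.
by case: (s == 0).
Qed.

Lemma trsq_count0_gt0 : (0 < N 0)%N.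
Proof. by rewrite odd_gt0 // trsq_count_odd. Qed.

(** Otherwise, by scaling, all squares would have trace 0, and polarization would give Tr(2x) = 0
    for every x. *)
Lemma trsq_count1_gt0 : (0 < N 1)%N.
Proof.
rewrite lt0n; apply/negP => /eqP N1.
have sq0 x : tr (x ^+ 2) = 0.
  apply/eqP; apply: contraT => /trsq_count_scale; rewrite N1 => /eqP.
  by rewrite cards_eq0 => /eqP/setP/(_ x); rewrite !inE eqxx.
have /eqP := two_neq0; apply; apply: Tr_nondeg => x.
have -> : 2%:R * x = (x + 1) ^+ 2 - x ^+ 2 - 1 ^+ 2 by ring.
by rewrite !TrB !sq0 !subr0.
Qed.

Lemma trsq_count_neq : N 0 != N 1.
Proof.
apply/eqP => E; have := trsq_count_odd 1; rewrite -E trsq_count_odd eqxx.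
by rewrite oner_eq0.
Qed.

Lemma card_Tr_power s :
  #|[set y : F | tr (y ^+ (p ^ u).+1) == s]| = N s.
Proof.
have [e eE oe] := half_exponent.
apply/esym/(card_eq_reindex (h := fun y : F => y ^+ e)) => [|y /=].
  by move=> x y; apply: (half_exponent_inj eE oe).
by rewrite -exprM eE muln2.
Qed.

(** * The Gauss sum *)

(** A nonzero x has 1 + eta(x) square roots, so G(eta) is the sum of zeta^Tr(y^2) minus that of
    zeta^Tr(y), which is 0. Grouping the former by s = Tr(y^2) leaves N(0) - N(1), since the zeta^s
    with s <> 0 sum to -1. *)
Lemma gauss_etaE : gauss_eta p m F = (N 0)%:R - (N 1)%:R.
Proof.
set z := zetap p; have z0 : \sum_(s : 'F_p) z ^+ s = 0 by exact: sum_zetap.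
have by_fiber (f : F -> F) : \sum_(y : F) z ^+ tr (f y) =
    \sum_(s : 'F_p) (#|[set y | tr (f y) == s]|)%:R * z ^+ s.
  rewrite (partition_big (fun y => tr (f y)) predT) //=; apply: eq_bigr => s _.
  rewrite (eq_bigr (fun _ => z ^+ s)) => [|y /eqP -> //].
  by rewrite sumr_const mulr_natl; congr (_ *+ _); apply: eq_card => y; rewrite !inE.
have sum_tr : \sum_(y : F) z ^+ tr y = 0.
  rewrite (by_fiber id) (eq_bigr (fun s : 'F_p => (p ^ (m - 1))%:R * z ^+ s)).
    by rewrite -big_distrr /= z0 mulr0.
  by move=> s _; rewrite card_Tr_fiber.
have sum_trsq : \sum_(y : F) z ^+ tr (y ^+ 2) = (N 0)%:R - (N 1)%:R.
  rewrite (by_fiber (fun y => y ^+ 2)) (bigD1 0) //= expr0 mulr1; congr (_ + _).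
  rewrite (eq_bigr (fun s : 'F_p => (N 1)%:R * z ^+ s)).
    move: z0; rewrite (bigD1 0) //= expr0 -big_distrr /= => /eqP.
    by rewrite addr_eq0 => /eqP {2}-> ; ring.
  by move=> s s0; rewrite -(trsq_count_scale s0).
suff : \sum_(y : F) z ^+ tr (y ^+ 2) = \sum_(y : F) z ^+ tr y + gauss_eta p m F.
  by rewrite sum_tr sum_trsq add0r.
rewrite (partition_big (fun y : F => y ^+ 2) predT) //= /gauss_eta.
rewrite (bigD1 0) // [X in _ = X + _](bigD1 0) //= -addrA -big_split /=.
have sqrt_sum x : \sum_(y : F | y ^+ 2 == x) z ^+ tr (y ^+ 2) =
    #|[set y : F | y ^+ 2 == x]|%:R * z ^+ tr x.
  rewrite (eq_bigr (fun _ => z ^+ tr x)) => [|y /eqP -> //].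
  by rewrite sumr_const mulr_natl; congr (_ *+ _); apply: eq_card => y; rewrite !inE.
rewrite sqrt_sum card_sqrt eqxx mul1r; congr (_ + _); apply: eq_bigr => x x0.
rewrite sqrt_sum card_sqrt (negPf x0) /Defs.eta; case: [exists y, y ^+ 2 == x]; ring.
Qed.

(** * Completing the square, and zeros of codewords *)

Local Notation d := ((p ^ u).+1).
Local Notation W := (fun a b => wt p m F u (cw p m F u a b)).

Lemma exists_shift : exists2 g : F -> F, injective g &
  forall b, #|[set y | tr (y ^+ d + b * y) == 0]| = N (tr (g b ^+ d)).
Proof.
have L_inj := linearized_inj.
have [K LK KL] := injF_bij L_inj.
exists (fun b => K (b ^+ (p ^ u))) => [|b].
  by apply: inj_comp (can_inj KL) _; exact: frob_inj.
have {KL} := KL (b ^+ (p ^ u)); move: (K _) => c cE.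
rewrite -card_Tr_power.
apply/esym/(card_eq_reindex (h := fun y => y + c)) => [|y /=]; first exact: addIr.
(* Raising by to the power p^u keeps its trace and brings in b^(p^u) = c + c^(p^(2u)); the result
   has the trace of the cross terms c y^(p^u) + c^(p^u) y of (y+c)^d. *)
rewrite TrD -(Tr_frob u (b * y)) exprMn -{}cE mulrDl !TrD.
have -> : c ^+ (p ^ (2 * u)) * y ^+ (p ^ u) = (c ^+ (p ^ u) * y) ^+ (p ^ u).
  by rewrite exprMn -exprM -expnD addnn mul2n.
rewrite Tr_frob !exprS frobD.
have -> : (y + c) * (y ^+ (p ^ u) + c ^+ (p ^ u)) =
   y * y ^+ (p ^ u) + (c * y ^+ (p ^ u) + c ^+ (p ^ u) * y) + c * c ^+ (p ^ u) by ring.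
by rewrite [tr (_ + c * _)]TrD -subr_eq0 addrK !TrD.
Qed.

(** The origin, absent from [D1], is kept: it is a zero of every codeword, and the total becomes the
    pure power p^(2m-1). *)
Definition zeros (a b : F) :=
  #|[set z : F * F | (tr (z.1 + z.2 ^+ d) == 0) && (tr (a * z.1 + b * z.2) == 0)]|.

Lemma zeros_sum a b : zeros a b =
  (\sum_y #|[set x | (tr x == - tr (y ^+ d)) && (tr (a * x) == - tr (b * y))]|)%N.
Proof.
rewrite [LHS](card_set_pair_swap
  (fun x y : F => (tr (x + y ^+ d) == 0) && (tr (a * x + b * y) == 0))).
by apply: eq_bigr => y _; apply: eq_card => x; rewrite !inE !TrD !addr_eq0.
Qed.

Lemma card_trace_zeros :
  #|[set z : F * F | tr (z.1 + z.2 ^+ d) == 0]| = (p ^ (2 * m - 1))%N.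
Proof.
rewrite [LHS](card_set_pair_swap (fun x y : F => tr (x + y ^+ d) == 0)).
rewrite (eq_bigr (fun _ => p ^ (m - 1))%N) => [|y _].
  by rewrite sum_nat_const hF -expnD addnBA // addnn -mul2n.
rewrite -(card_Tr_fiber (- tr (y ^+ d))); apply: eq_card => x.
by rewrite !inE TrD addr_eq0.
Qed.

Lemma card_D1 : #|D1 p m F u| = (p ^ (2 * m - 1) - 1)%N.
Proof.
rewrite -card_trace_zeros [in RHS](cardsD1 (0, 0)) inE /= exprS mul0r addr0 Tr0 eqxx addKn.
by apply: eq_card => z; rewrite !inE.
Qed.

Lemma wt_zeros a b : (W a b + zeros a b = p ^ (2 * m - 1))%N.
Proof.
rewrite -card_trace_zeros addnC -(cardsID [set z | tr (a * z.1 + b * z.2) == 0]).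
congr (_ + _)%N; apply: eq_card => z; first by rewrite !inE.
rewrite !inE ffunE inE; case: (eqVneq z (0, 0)) => [->|_] /=.
  by rewrite !mulr0 addr0 Tr0 eqxx.
by case: (tr (z.1 + z.2 ^+ d) == 0); rewrite ?andbT ?andbF.
Qed.

Lemma zeros_generic a b : (forall k, a != emb k) -> zeros a b = (p ^ (2 * m - 2))%N.
Proof.
move=> an; rewrite zeros_sum (eq_bigr (fun _ => p ^ (m - 2))%N) => [|y _].
  by rewrite sum_nat_const hF -expnD addnBA ?gt1_m // addnn -mul2n.
exact: card_Tr_fiber2.
Qed.

(** For a = 0 the second condition constrains y alone; each admissible y leaves a trace fibre for
    x. *)
Lemma zeros_left0 b : b != 0 -> zeros 0 b = (p ^ (2 * m - 2))%N.
Proof.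
move=> b0; rewrite zeros_sum.
rewrite (eq_bigr (fun y => if tr (b * y) == 0 then (p ^ (m - 1))%N else 0%N)) => [|y _].
  rewrite -big_mkcond sum_nat_const /= -cardsE.
  have <- := card_eq_reindex (P := fun y => tr y == 0) (mulfI b0) (fun y => erefl _).
  by rewrite card_Tr_fiber // -expnD addnn doubleB -mul2n.
case: ifP => tr_by; last first.
  by apply: eq_card0 => x; rewrite !inE mul0r Tr0 [0 == _]eq_sym oppr_eq0 tr_by andbF.
rewrite -(card_Tr_fiber (- tr (y ^+ d))); apply: eq_card => x.
by rewrite !inE mul0r Tr0 [0 == _]eq_sym oppr_eq0 tr_by andbT.
Qed.

(** Here Tr(kx) = k Tr(x) is fixed by the first condition, so the second becomes a condition on y
    alone. *)
Lemma zeros_prime k b : k != 0 ->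
  zeros (emb k) b = (p ^ (m - 1) * #|[set y | tr (y ^+ d - b / emb k * y) == 0%R]|)%N.
Proof.
move=> k0; have ek0 : emb k != 0 by rewrite embFp_eq0.
rewrite zeros_sum mulnC -sum_nat_const [RHS]big_mkcond /=; apply: eq_bigr => y _.
have E x : (tr x == - tr (y ^+ d)) && (tr (emb k * x) == - tr (b * y)) =
  (tr x == - tr (y ^+ d)) && (tr (y ^+ d - b / emb k * y) == 0).
  case: eqP => //= xE; rewrite TrZ xE mulrN eqr_opp.
  rewrite TrD TrN subr_eq0 -[RHS](inj_eq (mulfI k0)) -[X in _ = (_ == X)]TrZ.
  by rewrite mulrA (mulrC (emb k)) divfK.
rewrite inE; case: ifP => yE.
  rewrite -(card_Tr_fiber (- tr (y ^+ d))); apply: eq_card => x.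
  by rewrite !inE E yE andbT.
by apply: eq_card0 => x; rewrite !inE E yE andbF.
Qed.

(** * The three weights *)

Definition generic_wt := ((p - 1) * p ^ (2 * m - 2))%N.
(* The weight of c(a,b) for a in F_p^*, with s = Tr(c^d) in the notation of the
   header. *)
Definition prime_wt (s : 'F_p) := (p ^ (2 * m - 1) - p ^ (m - 1) * N s)%N.

Arguments prime_wt s%_ring_scope.

Lemma prime_wt_neq0 s : s != 0 -> prime_wt s = prime_wt 1.
Proof.
by move=> s0; rewrite /prime_wt (trsq_count_scale s0).
Qed.

Lemma wt_distinct :
  [/\ 0 < generic_wt, 0 < prime_wt 0 & 0 < prime_wt 1]%N /\
  [/\ generic_wt != prime_wt 0, generic_wt != prime_wt 1 & prime_wt 0 != prime_wt 1].
Proof.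
rewrite /generic_wt /prime_wt; have [e1 -> ->] := expn_split p hm.
have := trsq_count_total; rewrite e1.
have := trsq_count_neq.
have := trsq_count0_gt0; have := trsq_count1_gt0.
have p3 : (2 < p)%N by case: p hp hodd => [|[|[|]]].
have : (0 < p ^ (m - 1))%N by rewrite expn_gt0 prime_gt0.
move: (N 0) (N 1) => x y.
case: p p3 hp => // r r1 _ P0 b0 a0 ab E; rewrite subSS subn0 in E *.
by rewrite !mulnA -!(mulnA r.+1) -!(mulnA r); exact: weights_distinct.
Qed.

Definition prime_units : {set F} := [set emb k | k in [set~ 0]].

Lemma card_prime_units : #|prime_units| = (p - 1)%N.
Proof.
by rewrite card_imset ?cardsC1 ?card_Fp ?subn1 //; exact: embFp_inj.
Qed.

Lemma zero_notin_prime_units : 0 \notin prime_units.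
Proof.
apply/imsetP => -[k]; rewrite !inE => k0 /esym/eqP.
by rewrite embFp_eq0 (negPf k0).
Qed.

Lemma wt_zero : W 0 0 = 0%N.
Proof.
by apply: eq_card0 => z; rewrite !inE ffunE !mul0r addr0 Tr0; case: ifP; rewrite eqxx andbF.
Qed.

Lemma wt_generic a b : a \notin prime_units -> (a, b) != (0, 0) -> W a b = generic_wt.
Proof.
move=> aP ab.
suff zE : zeros a b = (p ^ (2 * m - 2))%N.
  have := wt_zeros a b; rewrite zE /generic_wt.
  by have [_ -> ->] := expn_split p hm; rewrite mulnBl mul1n => <-; rewrite addnK.
case: (eqVneq a 0) => [a0|a0].
  move: ab; rewrite a0 xpair_eqE eqxx /=; exact: zeros_left0.
apply: zeros_generic => // k; apply: contraNneq aP => ak; apply/imsetP.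
by exists k => //; rewrite !inE; apply: contra_neq a0 => k0; rewrite ak k0 embFp0.
Qed.

(** * Weights and multiplicities in terms of the Gauss sum *)

Local Notation G := (gauss_eta p m F).
Local Notation q := ((p ^ m)%:R : algC).
Local Notation w1 := (((p - 1) * p ^ (2 * m - 2))%:R : algC).

Lemma prime_wtE s : (prime_wt s)%:R =
  (p ^ (m - 1))%:R * (p%:R * (p ^ (m - 1))%:R - (N s)%:R) :> algC.
Proof.
rewrite /prime_wt; have [e1 -> _] := expn_split p hm.
(* The subtraction is not truncated, as N(s) is at most q. *)
rewrite mulnCA -mulnBr natrM natrB ?natrM // -e1 -hF; exact: max_card.
Qed.

Lemma pred_natr : (p - 1)%:R = p%:R - 1 :> algC.
Proof. by rewrite natrB ?prime_gt0. Qed.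

Lemma natr_p_neq0 : (p%:R != 0 :> algC) /\ ((p - 1)%:R != 0 :> algC) /\
  ((p ^ (m - 1))%:R != 0 :> algC).
Proof.
by rewrite !pnatr_eq0 -!lt0n subn_gt0 prime_gt1 // expn_gt0 prime_gt0.
Qed.

(** This solves N(0) + (p-1) N(1) = q and N(0) - N(1) = G. *)
Lemma trsq_count_gauss : p%:R * (N 0)%:R = q + (p - 1)%:R * G /\
  p%:R * (N 1)%:R = q - G.
Proof.
rewrite gauss_etaE -trsq_count_total.
by rewrite natrD natrM pred_natr; split; ring.
Qed.

Lemma weight0_gauss : w1 * (1 - G / q) = (prime_wt 0)%:R.
Proof.
have [p0 [r0 P0]] := natr_p_neq0; have [e1 _ e2] := expn_split p hm.
have [+ _] := trsq_count_gauss; rewrite prime_wtE e2 e1 !natrM => /(canRL (mulKf p0)) ->.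
by rewrite pred_natr; field; rewrite p0 P0.
Qed.

Lemma weight1_gauss : w1 * (1 + G / ((p - 1)%:R * q)) = (prime_wt 1)%:R.
Proof.
have [p0 [r0 P0]] := natr_p_neq0; have [e1 _ e2] := expn_split p hm.
have [_] := trsq_count_gauss; rewrite prime_wtE e2 e1 !natrM => /(canRL (mulKf p0)) ->.
move: r0; rewrite pred_natr => r0.
by field; rewrite p0 P0 r0.
Qed.

Lemma multiplicity0_gauss : ((p - 1) * N 0)%:R =
  ((p - 1) * p ^ (m - 1))%:R * (1 + (p - 1)%:R * G / q) :> algC.
Proof.
have [p0 [_ P0]] := natr_p_neq0; have [e1 _ _] := expn_split p hm.
have [+ _] := trsq_count_gauss; rewrite e1 !natrM => /(canRL (mulKf p0)) ->.
by field; rewrite p0 P0.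
Qed.

Lemma multiplicity1_gauss : ((p - 1) * (p ^ m - N 0))%:R =
  ((p - 1) * p ^ (m - 1))%:R * ((p - 1)%:R - (p - 1)%:R * G / q) :> algC.
Proof.
have [p0 [_ P0]] := natr_p_neq0; have [e1 _ _] := expn_split p hm.
rewrite natrM [(p ^ m - _)%:R]natrB; last by rewrite -hF max_card.
have [+ _] := trsq_count_gauss; rewrite e1 !natrM => /(canRL (mulKf p0)) ->.
by rewrite pred_natr; field; rewrite p0 P0.
Qed.

(** * The weight distribution *)

Section Shift.
(* g is the bijection B |-> c of the header. *)
Context (g : F -> F) (g_inj : injective g)
  (gE : forall b, #|[set y | tr (y ^+ d + b * y) == 0]| = N (tr (g b ^+ d))).

Lemma wt_prime a b : a \in prime_units ->
  W a b = prime_wt (tr (g (- (b / a)) ^+ d)).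
Proof.
case/imsetP => k; rewrite !inE => k0 ->.
have := wt_zeros (emb k) b; rewrite (zeros_prime b k0).
have -> : #|[set y | tr (y ^+ d - b / emb k * y) == 0]| = N (tr (g (- (b / emb k)) ^+ d)).
  by rewrite -gE; apply: eq_card => y; rewrite !inE mulNr.
by rewrite /prime_wt => <-; rewrite addnK.
Qed.

(** For each of the p-1 values of a in F_p^*, b runs bijectively with c = g(-b/a); every other a
    gives only the two excluded weights. *)
Lemma count_prime_wt w : w != 0%N -> w != generic_wt ->
  #|[set z | W z.1 z.2 == w]| =
  ((p - 1) * #|[set c | prime_wt (tr (c ^+ d)) == w]|)%N.
Proof.
move=> w0 wg; rewrite (card_set_pair (fun a b => W a b == w)).
rewrite -card_prime_units -sum_nat_const [RHS]big_mkcond /=.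
apply: eq_bigr => a _; case: ifPn => aP.
  have a0 : a != 0 by apply: contraTneq aP => ->; exact: zero_notin_prime_units.
  apply/esym/(card_eq_reindex (h := fun b => g (- (b / a)))) => [b b'|b /=].
    by move/g_inj/oppr_inj/(mulIf (invr_neq0 a0)).
  by rewrite wt_prime.
apply: eq_card0 => b; rewrite !inE; apply/negbTE.
case: (eqVneq (a, b) (0, 0)) => [[-> ->]|ab]; first by rewrite wt_zero eq_sym.
by rewrite wt_generic // eq_sym.
Qed.

Lemma wt_eq0 a b : (W a b == 0)%N = ((a, b) == (0, 0)).
Proof.
have [[g0 p0 p1] _] := wt_distinct.
case: (eqVneq (a, b) (0, 0)) => [[-> ->]|ab]; first by rewrite wt_zero eqxx.
apply/negbTE; rewrite -lt0n; case: (boolP (a \in prime_units)) => aP.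
  rewrite wt_prime //; case: (eqVneq (tr (g (- (b / a)) ^+ d)) 0) => [->//|].
  by move/prime_wt_neq0 ->.
by rewrite wt_generic.
Qed.

Lemma prime_wt_eq0 s : (prime_wt s == prime_wt 0) = (s == 0).
Proof.
have [_ [_ _ p01]] := wt_distinct.
case: (eqVneq s 0) => [->|s0]; first exact: eqxx.
by rewrite prime_wt_neq0 // eq_sym (negPf p01).
Qed.

Lemma prime_wt_eq1 s : (prime_wt s == prime_wt 1) = (s != 0).
Proof.
have [_ [_ _ p01]] := wt_distinct.
case: (eqVneq s 0) => [->|s0]; first by rewrite (negPf p01).
by rewrite prime_wt_neq0 // eqxx.
Qed.

Lemma count_prime_wt0 : #|[set z | W z.1 z.2 == prime_wt 0]| = ((p - 1) * N 0)%N.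
Proof.
have [[_ p0 _] [gp0 _ _]] := wt_distinct.
rewrite count_prime_wt ?(eq_sym _ generic_wt) -?lt0n //; congr (_ * _)%N.
rewrite -card_Tr_power; apply: eq_card => c.
by rewrite !inE prime_wt_eq0.
Qed.

Lemma count_prime_wt1 :
  #|[set z | W z.1 z.2 == prime_wt 1]| = ((p - 1) * (p ^ m - N 0))%N.
Proof.
have [[_ _ p1] [_ gp1 _]] := wt_distinct.
rewrite count_prime_wt ?(eq_sym _ generic_wt) -?lt0n //; congr (_ * _)%N.
rewrite -card_Tr_power -hF.
rewrite -(cardsC [set c | tr (c ^+ d) == 0]) addKn; apply: eq_card => c.
by rewrite !inE prime_wt_eq1.
Qed.

(** Counted by complement: the remaining pairs are (0,0) and those with a in F_p^*. *)
Lemma count_generic_wt :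
  (#|[set z | W z.1 z.2 == generic_wt]| + ((p - 1) * p ^ m).+1 = p ^ (2 * m))%N.
Proof.
have [[g0 _ _] [gp0 gp1 _]] := wt_distinct.
rewrite mul2n -addnn expnD -hF -card_prod -(cardsC [set z | W z.1 z.2 == generic_wt]).
congr (_ + _)%N; rewrite -card_prime_units -cardsT -cardsX.
transitivity #|(0, 0) |: setX prime_units [set: F]|.
  by rewrite cardsU1 inE /= (negPf zero_notin_prime_units).
apply: eq_card => -[a b]; rewrite !inE andbT /=.
case: (eqVneq (a, b) (0, 0)) => [[-> ->]|ab] /=.
  by rewrite wt_zero eq_sym -lt0n g0.
case: (boolP (a \in prime_units)) => aP; last by rewrite wt_generic // eqxx.
rewrite wt_prime // eq_sym.
by case: (eqVneq (tr (g (- (b / a)) ^+ d)) 0) => [->|/prime_wt_neq0 ->].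
Qed.

(** Codewords depend additively on (a,b), and only (0,0) gives weight 0. *)
Lemma cw_inj : injective (fun z => cw p m F u z.1 z.2).
Proof.
move=> [a b] [a' b'] /= cE; apply/eqP.
suff : (a - a', b - b') == (0, 0) by rewrite !xpair_eqE !subr_eq0.
rewrite -wt_eq0 cards_eq0; apply/eqP/setP => z; rewrite !inE ffunE; move/ffunP/(_ z): cE.
rewrite !ffunE; case: ifP => zD; last by rewrite eqxx andbF.
by rewrite !mulrBl addrACA -opprD TrB => ->; rewrite subrr eqxx andbF.
Qed.

(** For a linear code over F_p this size expresses dimension 2m. *)
Lemma card_code : #|code p m F u| = (p ^ (2 * m))%N.
Proof.
by rewrite card_imset ?card_prod ?hF -?expnD ?addnn -?mul2n //; exact: cw_inj.
Qed.

Lemma mult_nat w : mult p m F u w%:R = #|[set z | W z.1 z.2 == w]|.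
Proof.
rewrite -(card_imset _ cw_inj); apply: eq_card => c.
rewrite inE; apply/andP/imsetP => [[/imsetP[z _ ->]]|[z + ->]]; rewrite ?inE eqr_nat.
  by move=> zw; exists z; rewrite ?inE.
by move=> zw; split=> //; apply: imset_f.
Qed.

Lemma wt_in_code w : (0 < #|[set z | W z.1 z.2 == w]|)%N ->
  exists2 c, c \in code p m F u & wt p m F u c = w.
Proof.
case/card_gt0P => z; rewrite inE => /eqP zw.
by exists (cw p m F u z.1 z.2) => //; apply: imset_f.
Qed.

Lemma wt_cases a b : (a, b) != (0, 0) ->
  W a b \in [:: generic_wt; prime_wt 0; prime_wt 1].
Proof.
move=> ab; rewrite !inE; case: (boolP (a \in prime_units)) => aP.
  rewrite wt_prime //.
  have [->|] := eqVneq (tr (g (- (b / a)) ^+ (p ^ u).+1)) 0.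
    by rewrite eqxx orbT.
  by move/prime_wt_neq0 ->; rewrite eqxx !orbT.
by rewrite wt_generic ?eqxx.
Qed.

Lemma three_weights :
  size (undup [seq wt p m F u c | c <- enum (code p m F u) & wt p m F u c != 0%N]) = 3%N.
Proof.
have [[g0 w0 w1] [gn0 gn1 n01]] := wt_distinct.
pose ws := [:: generic_wt; prime_wt 0; prime_wt 1].
apply: (@perm_size _ _ ws); apply: uniq_perm; rewrite ?undup_uniq //.
  by rewrite /= !inE negb_or gn0 gn1 n01.
move=> w; rewrite mem_undup; apply/mapP/idP => [[c]|].
  rewrite mem_filter mem_enum => /andP[c0 /imsetP[[a b] _ cE]] ->.
  by move: c0; rewrite cE /= wt_eq0; exact: wt_cases.
move=> wws; suff [c cc cw] : exists2 c, c \in code p m F u & wt p m F u c = w.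
  exists c => //; rewrite mem_filter mem_enum cc cw andbT -lt0n.
  by move: wws; rewrite !inE => /or3P[] /eqP ->.
apply: wt_in_code; move: wws; rewrite !inE => /or3P[] /eqP ->.
(* Since 0 is outside F_p^*, c(0,1) has the generic weight; the other two weights occur because N(0)
   and q - N(0) = (p-1) N(1) are positive. *)
- apply/card_gt0P; exists (0, 1); rewrite inE /= wt_generic //.
    exact: zero_notin_prime_units.
  by rewrite xpair_eqE oner_eq0 andbF.
- rewrite count_prime_wt0 muln_gt0 subn_gt0 prime_gt1 //.
  exact: trsq_count0_gt0.
rewrite count_prime_wt1 muln_gt0 !subn_gt0 prime_gt1 //.
rewrite -trsq_count_total -[X in (X < _)%N]addn0 ltn_add2l.
by rewrite muln_gt0 subn_gt0 prime_gt1 // trsq_count1_gt0.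
Qed.

End Shift.

End Code.

Unset Implicit Arguments.

Theorem theorem2 (p m u : nat) (F : finFieldType)
  (hp : prime p) (hodd : odd p) (hm : (0 < m)%N) (hu : (0 < u)%N)
  (hF : #|F| = (p ^ m)%N)
  (hmv : odd (m %/ gcdn m u)) (hv : ~~ odd (gcdn m u)) :
  let q : algC := (p ^ m)%:R in
  let G := gauss_eta p m F in
  let w1 : algC := ((p - 1) * p ^ (2 * m - 2))%:R in
  [/\ #|D1 p m F u| = (p ^ (2 * m - 1) - 1)%N,
      #|code p m F u| = (p ^ (2 * m))%N,
      size (undup [seq wt p m F u c | c <- enum (code p m F u) & wt p m F u c != 0%N]) = 3%N
    & [/\ mult p m F u 0 = 1%N,
          (mult p m F u w1)%:R
            = (p ^ (2 * m))%:R - 1 - (p - 1)%:R * (p ^ m)%:R :> algC,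
          (mult p m F u (w1 * (1 - G / q)))%:R
            = ((p - 1) * p ^ (m - 1))%:R * (1 + (p - 1)%:R * G / q) :> algC
        & (mult p m F u (w1 * (1 + G / ((p - 1)%:R * q))))%:R
            = ((p - 1) * p ^ (m - 1))%:R * ((p - 1)%:R - (p - 1)%:R * G / q)
              :> algC]].
Proof.
move=> q G w1.
have [g g_inj gE] := exists_shift hp hm hF hodd hmv hv.
split.
- exact: card_D1.
- exact: (card_code hp hm hF hodd hv gE).
- exact: (three_weights hp hm hF hodd hmv hv g_inj gE).
rewrite /w1 /q /G (weight0_gauss hp hm hF hodd hv) (weight1_gauss hp hm hF hodd hv).
(* With all four weights written as casts of naturals, multiplicities become counts of pairs
   (a,b). *)
rewrite -[mult p m F u 0]/(mult p m F u 0%:R) !(mult_nat hp hm hF hodd hv gE).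
split.
- transitivity #|[set (0, 0) : F * F]|; last exact: cards1.
  by apply: eq_card => -[a b]; rewrite !inE (wt_eq0 hp hm hF hodd hv gE).
- rewrite -(count_generic_wt hp hm hF hodd hv gE) natrD -natr1 natrM /generic_wt; ring.
- by rewrite (count_prime_wt0 hp hm hF hodd hmv hv g_inj gE) (multiplicity0_gauss hp hm hF hodd hv).
- by rewrite (count_prime_wt1 hp hm hF hodd hmv hv g_inj gE) (multiplicity1_gauss hp hm hF hodd hv).
Qed.
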